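(* Let $H$ be an infinite-dimensional separable Hilbert space and let $V$ be a dense subspace of $H$, endowed with a Hilbert structure such that the inclusion map $V\to H$ is compact. Let $A\in\mathcal{L}(V,V')$ be the duality map of $V$ and let $0<\lambda_1\le\lambda_2\le\cdots$ be its eigenvalues, repeated according to multiplicity. Assume that there exist positive constants $c$ and $\alpha$ such that $\lambda_j\ge c\,j^{\alpha}$ for all $j\ge 1$. Let $B_V(0,1)=\{u\in V:\ \|u\|_V\le 1\}$. Then the Kolmogorov $\varepsilon$-entropy of $B_V(0,1)$ in $H$ satisfies $$\forall \varepsilon>0,\qquad \mathcal{H}_{\varepsilon}(B_V(0,1),H)<\left(\frac{\log 3+\alpha}{\log 2}\right)\left(\frac{2}{c\,\varepsilon^2}\right)^{1/\alpha}.$$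
   Context: For a precompact subset $M$ of a metric space $X$ and $\varepsilon>0$, $N_\varepsilon(M,X)$ denotes the minimal number of closed balls of radius $\varepsilon$ in $X$ (centers in $X$) needed to cover $M$, and $\mathcal{H}_\varepsilon(M,X)=\log_2 N_\varepsilon(M,X)$ is the Kolmogorov $\varepsilon$-entropy. $\log$ is the natural logarithm. $H$ has norm $|\cdot|_H$ and scalar product $(\cdot,\cdot)_H$; $V$ has norm $\|\cdot\|_V$ and scalar product $(\cdot,\cdot)_V$. $H$ is identified with its dual, so that $V\subset H\subset V'$ with continuous inclusions, and $\langle\cdot,\cdot\rangle$ is the duality product between $V'$ and $V$. The duality map $A:V\to V'$ is defined by $\langle Au,v\rangle=(u,v)_V$ for all $u,v\in V$. Its inverse, restricted to $H$, is a compact positive self-adjoint operator on $H$; hence there are an orthonormal basis $(w_j)_{j\ge1}$ of $H$ and a nondecreasing sequence $0<\lambda_1\le\lambda_2\le\cdots$ with $\lambda_j\to+\infty$ and $Aw_j=\lambda_j w_j$ for all $j\ge 1$ (eigenvalues repeated according to multiplicity). *)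

(* Defs.v *)
From HB Require Import structures.
From mathcomp Require Import all_boot all_order all_algebra.
From mathcomp Require Import sesquilinear.
From mathcomp Require Import all_classical all_reals all_analysis.
From mathcomp Require Import ring lra.

Set Implicit Arguments.
Unset Strict Implicit.
Unset Printing Implicit Defensive.

Import Order.TTheory GRing.Theory Num.Theory.
Import numFieldNormedType.Exports.

Local Open Scope classical_set_scope.
Local Open Scope ring_scope.

HB.mixin Record CompleteNormed_isHilbert (R : realType) (H : Type)
    & CompleteNormedModule R H := {
  inner : {dot H for (@idfun R)};
  inner_normE : forall x : H, `|x| ^+ 2 = inner x x }.

#[short(type="hilbertType")]
HB.structure Definition Hilbert (R : realType) :=
  {H of CompleteNormedModule R H & CompleteNormed_isHilbert R H}.

Definition infinite_dimensional (R : realType) (E : lmodType R) : Prop :=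
  ~ exists (n : nat) (e : 'I_n -> E),
      forall x, exists a : 'I_n -> R, x = \sum_(j < n) a j *: e j.

Definition separable (T : topologicalType) : Prop :=
  exists2 D : set T, countable D & dense D.

Definition compact_map (R : realType) (E F : normedModType R) (f : E -> F) :
    Prop :=
  forall B : set E, bounded_set B -> precompact (f @` B).

Lemma compact_map_continuous (R : realType) (E F : normedModType R)
  (f : {linear E -> F}) : compact_map f -> continuous f.
Proof.
move=> fc; apply/linear_bounded_continuous.
have /fc : bounded_set [set x : E | `|x| <= 1].
  by exists 1; split=> // M /ltW M1 x /= /le_trans; apply.
rewrite precompactE => /compact_bounded[M [Mr fM]].
exists M; split=> // N /fM fN; rewrite nbhs_ballP; exists 1 => //= x.
rewrite -ball_normE /= sub0r normrN => /ltW x1.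
by apply: fN; apply: subset_closure; exists x.
Qed.

Record dual (R : realType) (E : normedModType R) : Type := Dual {
  dual_fun :> {linear E -> R^o};
  dual_continuous : continuous dual_fun }.

Lemma dual_ext (R : realType) (E : normedModType R) (phi psi : dual E) :
  phi =1 psi -> phi = psi.
Proof.
case: phi psi => [f fc] [g gc] /= /funext fg.
suff fgE : f = g.
  by case: g / fgE gc fg => gc _; congr Dual; exact: Prop_irrelevance.
case: f g fg {fc gc} => [f [[f1] [f2]]] [g [[g1] [g2]]] /= fg.
case: g / fg g1 g2 => g1 g2.
by rewrite (Prop_irrelevance f1 g1) (Prop_irrelevance f2 g2).
Qed.

Definition dual_restrict (R : realType) (E F : normedModType R)
    (f : {linear E -> F}) (fc : continuous f) (phi : dual F) : dual E :=
  @Dual R E (phi \o f)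
    (fun x => continuous_comp (fc x) (@dual_continuous R F phi (f x))).

Section duality_map.
Context {R : realType} {E : hilbertType R}.

Lemma innerC (x y : E) : inner x y = inner y x.
Proof. by rewrite (hermC (inner : {dot E for idfun})) expr0 mul1r. Qed.

Lemma inner_le_norm (x y : E) : `|inner x y| <= `|x| * `|y|.
Proof.
have sub_ge0 (a b : R) :
    0 <= a ^+ 2 * `|x| ^+ 2 + 2 * (a * b) * inner x y + b ^+ 2 * `|y| ^+ 2.
  have -> : a ^+ 2 * `|x| ^+ 2 + 2 * (a * b) * inner x y + b ^+ 2 * `|y| ^+ 2 =
      `|a *: x + b *: y| ^+ 2.
    have lin z : inner (a *: x + b *: y) z = a * inner x z + b * inner y z.
      by rewrite linearDl !linearZl_LR.
    rewrite !inner_normE lin ![inner _ (_ + _)]innerC !lin (innerC y x).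
    by ring.
  exact: sqr_ge0.
have [-> | x0] := eqVneq x 0; first by rewrite linear0l !normr0 mul0r.
have [-> | y0] := eqVneq y 0; first by rewrite linear0 !normr0 mulr0.
have xy0 : 0 < `|x| * `|y| by rewrite mulr_gt0 ?normr_gt0.
rewrite ler_norml; apply/andP; split.
  by rewrite -(ler_pM2l xy0); have := sub_ge0 `|y| `|x|; nra.
by rewrite -(ler_pM2l xy0); have := sub_ge0 `|y| (- `|x|); nra.
Qed.

Definition riesz (u : E) : E -> R^o := inner u.

Fact riesz_is_linear (u : E) : linear (riesz u).
Proof. by move=> a x y; rewrite /riesz linearD linearZ. Qed.

HB.instance Definition _ (u : E) :=
  GRing.isLinear.Build R E R^o *:%R (riesz u) (riesz_is_linear u).

Fact riesz_continuous (u : E) : continuous (riesz u).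
Proof.
apply/linear_bounded_continuous; exists `|u|; split; first exact: num_real.
move=> M /ltW uM; rewrite nbhs_ballP; exists 1 => //= x.
rewrite -ball_normE /= sub0r normrN => /ltW x1.
rewrite (le_trans (inner_le_norm u x))// (le_trans _ uM)//.
by rewrite ler_piMr.
Qed.

Definition duality_map (u : E) : dual E := Dual (@riesz_continuous u).

Lemma duality_mapE (u v : E) : duality_map u v = inner u v.
Proof. by []. Qed.

End duality_map.

Section gelfand_triple.
Context {R : realType} {V H : hilbertType R}.
Variables (i : {linear V -> H}) (i_compact : compact_map i).

(** The inclusion of H in the dual of V, H being identified with its own dual:
    h is sent to v |-> (h, i v)_H. *)
Definition to_dual (h : H) : dual V :=
  dual_restrict (compact_map_continuous i_compact) (duality_map h).

Lemma to_dualE (h : H) (v : V) : to_dual h v = inner h (i v).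
Proof. by []. Qed.

Definition orthonormal_basis (e : nat -> H) : Prop :=
  (forall j k, inner (e j) (e k) = (j == k)%:R) /\
  dense [set x : H | exists (n : nat) (a : nat -> R),
           x = \sum_(j < n) a j *: e j].

(** lam lists the eigenvalues of the duality map of V in nondecreasing order,
    repeated according to multiplicity: it is the sequence of eigenvalues
    attached to an orthonormal basis of H made of eigenvectors. The indices are
    shifted by one: lam j is the eigenvalue of index j + 1. *)
Definition eigenvalue_sequence (lam : nat -> R) : Prop :=
  [/\ 0 < lam 0%N, nondecreasing_seq lam, lam @ \oo --> +oo
    & exists w : nat -> V, orthonormal_basis (i \o w) /\
        forall j, duality_map (w j) = to_dual (lam j *: i (w j))].

End gelfand_triple.

Section entropy.
Context {R : realType} {X : normedModType R}.
Implicit Types (M : set X) (eps : R) (n : nat).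

Definition coverable M eps n : Prop :=
  exists x : 'I_n -> X, M `<=` \bigcup_j closed_ball_ Num.norm (x j) eps.

(** The infimum is the minimum as soon as M is covered by finitely many balls,
    and +oo otherwise. *)
Definition covering_number M eps : \bar R :=
  ereal_inf [set n%:R%:E | n in coverable M eps].

Lemma covering_number_min M eps :
  (exists n, coverable M eps n) ->
  exists n, [/\ coverable M eps n, forall m, coverable M eps m -> (n <= m)%N
              & covering_number M eps = n%:R%:E].
Proof.
move=> ex; have ex' : exists n, `[< coverable M eps n >].
  by case: ex => n /asboolP; exists n.
case: (ex_minnP ex') => n /asboolP cn min_n; exists n.
have min m : coverable M eps m -> (n <= m)%N by move/asboolP; exact: min_n.
split=> //; apply/eqP; rewrite eq_le; apply/andP; split.
  by apply: ereal_inf_lbound; exists n.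
by apply: le_ereal_inf_tmp => _ [m /min nm <-]; rewrite lee_fin ler_nat.
Qed.

Definition entropy M eps : \bar R :=
  (lne (covering_number M eps) * ((ln 2)^-1)%:E)%E.

End entropy.

(* Main.v *)
(** With L = 2 / eps^2 and n the number of eigenvalues below L, drop the
    coordinates of index above n: for u of V-norm at most 1 whose first n
    coordinates a_j carry the energy Q = sum lam_j a_j^2, this costs
    (1 - Q) / L in squared H-norm, so that the first n coordinates may be
    quantized with squared error (1 + Q) / L.  After the rescaling a_j^2 L and
    mu_j = lam_j / L < 1, the j-th coordinate is rounded to a grid of step
    2 eta_j, where (1 - mu_j) eta_j^2 = 1 / n: an error d bounded both by eta_j
    and by |a_j| then satisfies d^2 <= 1 / n + mu_j a_j^2.  The grid points in
    use satisfy sum r_j depth_j <= n with r_j = mu_j / (1 - mu_j), and the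
    weights exp (n - sum r_j depth_j) >= 1 factor over the coordinates, each
    of which contributes e (1 + 1 / sinh r_j) <= e (1 + 1 / r_j) = e / mu_j.
    With m = (2 / (c eps^2))^(1/alpha), which is at least n, the number of
    balls is at most e^n (m^n / n!)^alpha <= e^(m (1 + alpha)), and 1 < log 3. *)
Require Import Defs.
From mathcomp Require Import all_boot all_order all_algebra.
From mathcomp Require Import all_classical all_reals all_analysis.
From mathcomp Require Import ring lra.

Import Order.TTheory GRing.Theory Num.Theory.
Import numFieldNormedType.Exports.

Local Open Scope classical_set_scope.
Local Open Scope ring_scope.

(** * Exponential weights and quantization of one coordinate *)

Lemma expR_ge1Dx2 (R : realType) (x : R) :
  0 <= x -> 1 + x + x ^+ 2 / 2 <= expR x.
Proof.
move=> x0; have nd : nondecreasing_seq (series (exp_coeff x)).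
  by apply: nondecreasing_series => n _ _; exact: exp_coeff_ge0.
have := nondecreasing_cvgn_le nd (is_cvg_series_exp_coeff x) 3%N.
rewrite /series/= !big_nat_recr//= big_geq// /exp_coeff/=.
by rewrite expr0 expr1 !fact0 factS fact0 !muln1 !divr1 add0r.
Qed.

(** The sum telescopes: 2 r exp(-(2k+1)r) <= exp(-2kr) - exp(-2(k+1)r), which amounts to r <= sinh
    r. *)
Lemma sum_expR_odd (R : realType) (r : R) (K : nat) : 0 < r ->
  2 * \sum_(k < K) expR (- (r * (2 * k + 1)%:R)) <= r^-1.
Proof.
move=> r0.
have E : 1 + 2 * r * expR r <= expR r ^+ 2.
  by have := @expR_ge1Dx2 _ r (ltW r0); nra.
suff S : r * (2 * \sum_(k < K) expR (- (r * (2 * k + 1)%:R))) <=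
    1 - expR (- (r * (2 * K)%:R)).
  by rewrite -(ler_pM2l r0) divff ?gt_eqF// (le_trans S)// gerBl expR_ge0.
elim: K => [|K IH]; first by rewrite big_ord0 muln0 !mulr0 oppr0 expR0 subrr.
rewrite big_ord_recr/= !mulrDr; set q := expR (- (r * (2 * K)%:R)).
have -> : expR (- (r * (2 * K + 1)%:R)) = q * expR (- r).
  by rewrite -expRD natrD; congr expR; ring.
have -> : expR (- (r * (2 * K.+1)%:R)) = q * expR (- r) ^+ 2.
  by rewrite expr2 -!expRD mulnS natrD; congr expR; ring.
have e1 : expR r * expR (- r) = 1 by rewrite -expRD subrr expR0.
have q0 : 0 <= q := expR_ge0 _.
have E2 : expR (- r) ^+ 2 + 2 * r * expR (- r) <= 1.
  have := ler_wpM2r (sqr_ge0 (expR (- r))) E.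
  have -> : (1 + 2 * r * expR r) * expR (- r) ^+ 2 =
    expR (- r) ^+ 2 + 2 * r * expR (- r) * (expR r * expR (- r)) by ring.
  by rewrite -exprMn e1 expr1n mulr1.
have := ler_wpM2l q0 E2; rewrite mulrDr mulr1; move: IH; rewrite -/q; lra.
Qed.

(** An exponential Markov bound: the indicator of the condition is at most exp(B - sum of the
    weights), whose sum over all [f] factors. *)
Lemma card_weight_le (R : realType) (n : nat) (T : finType)
    (w : 'I_n -> T -> R) (B : R) :
  #|[pred f : {ffun 'I_n -> T} | \sum_j w j (f j) <= B]|%:R <=
    expR B * \prod_j \sum_t expR (- w j t).
Proof.
rewrite bigA_distr_bigA/= mulr_sumr -sum1_card natr_sum big_mkcond/=.
apply: ler_sum => f _; rewrite -expR_sum -expRD sumrN.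
case: ifPn => [|_]; last exact: expR_ge0.
by rewrite inE => h; rewrite -[1]expR0 ler_expR subr_ge0.
Qed.

(** A cell is the central interval [-eta, eta] or, on either side of it, one of
    K intervals of length 2 eta. Its depth is its distance to 0 in units of
    eta. *)
Definition cell (K : nat) : finType := (unit + bool * 'I_K)%type.

(** In units of [eta], the side cell of index [k] covers absolute values from 2k+1 to 2k+3; [b] is
    true on the negative side. *)
Definition cell_center {R : realType} {K : nat} (t : cell K) : R :=
  if t is inr (b, k) then (-1) ^+ b * (2 * k.+1)%:R else 0.

Definition cell_depth {R : realType} {K : nat} (t : cell K) : R :=
  if t is inr (b, k) then (2 * k + 1)%:R else 0.

Lemma sum_cell_depth (R : realType) (r : R) (K : nat) : 0 < r ->
  \sum_(t : cell K) expR (- (r * cell_depth t)) <= 1 + r^-1.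
Proof.
move=> r0; rewrite big_sumType/=; apply: lerD.
  by rewrite (bigD1 tt)//= big1 ?addr0 ?mulr0 ?oppr0 ?expR0//; case.
rewrite (eq_bigr (fun p : bool * 'I_K => expR (- (r * (2 * p.2 + 1)%:R)))).
  rewrite -(pair_bigA _
    (fun (b : bool) (k : 'I_K) => expR (- (r * (2 * k + 1)%:R))))/=.
  by rewrite big_const card_bool/= addr0 -mulr2n -mulr_natl; exact: sum_expR_odd.
by case.
Qed.

(** The last bound holds because the central cell has centre 0, while off centre the error is at
    most eta < |a|. *)
Lemma cell_exists (R : realType) (a eta : R) (K : nat) :
  0 < eta -> `|a| < (2 * K + 1)%:R * eta ->
  exists t : cell K, [/\ cell_depth t * eta <= `|a|,
    `|a - cell_center t * eta| <= eta & `|a - cell_center t * eta| <= `|a|].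
Proof.
move=> eta0 aK; have [ae|ea] := leP `|a| eta.
  by exists (inl tt); rewrite /= !mul0r subr0.
pose k := Num.truncn ((`|a| - eta) / (2 * eta)).
have e0 : 0 < 2 * eta by lra.
have /andP[kl ku] : k%:R <= (`|a| - eta) / (2 * eta) < k.+1%:R.
  by apply/truncn_itv/divr_ge0; lra.
move: kl ku; rewrite ler_pdivlMr// ltr_pdivrMr// => kl ku.
have kK : (k < K)%N.
  rewrite -(ltr_nat R); move: aK kl; rewrite natrD natrM => aK kl.
  by rewrite -(ltr_pM2r e0); lra.
have D : `|a - (-1) ^+ (a < 0)%R * (2 * k.+1)%:R * eta| <= eta.
  rewrite [X in X - _]numEsign -!mulrA -mulrBr normrMsign.
  rewrite ler_norml natrM.
  by move: kl ku; rewrite -natr1 => kl ku; apply/andP; split; lra.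
exists (inr ((a < 0)%R, Ordinal kK)); rewrite /= natrD natrM.
split => //; first by lra.
by rewrite (le_trans D)// ltW.
Qed.

(** Depths are natural numbers. This passes from the squared depth, controlled by the energy, to the
    linear depth of the counting weights. *)
Lemma cell_depth_le_sqr (R : realType) (K : nat) (t : cell K) :
  0 <= (cell_depth t : R) <= cell_depth t ^+ 2.
Proof.
case: t => [u|[b k]] /=; first by rewrite expr0n lexx.
by rewrite ler0n -natrX ler_nat leq_pmulr ?expn_gt0 ?addn1.
Qed.

(** * Nets of finite-dimensional ellipsoids *)

Lemma ellipsoid_net (R : realType) (n : nat) (mu : 'I_n -> R) :
  (forall j, 0 < mu j < 1) ->
  exists (N : nat) (c : 'I_N -> 'I_n -> R),
    N%:R <= \prod_j (expR 1 / mu j) /\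
    forall a : 'I_n -> R, \sum_j mu j * a j ^+ 2 <= 1 ->
      exists k, \sum_j (a j - c k j) ^+ 2 <= 1 + \sum_j mu j * a j ^+ 2.
Proof.
move=> mu01; have mu0 j : 0 < mu j by case/andP: (mu01 j).
have mu1 j : 0 < 1 - mu j by rewrite subr_gt0; case/andP: (mu01 j).
have n0 (j : 'I_n) : 0 < n%:R :> R.
  by rewrite ltr0n; case: j => j /=; exact: leq_trans.
pose r j := mu j / (1 - mu j); have r0 j : 0 < r j by rewrite divr_gt0.
pose eta j := Num.sqrt (n%:R * (1 - mu j))^-1.
have eta0 j : 0 < eta j by rewrite sqrtr_gt0 invr_gt0 mulr_gt0// n0.
have etaE j : eta j ^+ 2 * (1 - mu j) = n%:R^-1.
  rewrite sqr_sqrtr; last by rewrite invr_ge0 mulr_ge0// ltW.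
  by rewrite invfM -mulrA mulVf ?mulr1// gt_eqF.
have rE j : r j = n%:R * (mu j * eta j ^+ 2).
  rewrite /r sqr_sqrtr; last by rewrite invr_ge0 mulr_ge0// ltW.
  by field; rewrite !gt_eqF// n0.
(* One [K] serves all coordinates: since a_j^2 <= 1 / mu_j = (n / r_j) eta_j^2, no [a j] falls
   outside the cells. *)
pose K := (\sum_j (Num.truncn (n%:R / r j)).+1)%N.
have K_gt j : n%:R / r j < K%:R.
  apply: lt_le_trans (truncnS_gt _) _.
  by rewrite ler_nat /K (bigD1 j)//= leq_addr.
pose A := [pred f : {ffun 'I_n -> cell K} |
  \sum_j r j * cell_depth (f j) <= n%:R].
exists #|A|, (fun k j =>
  cell_center ((enum_val k : {ffun 'I_n -> cell K}) j) * eta j); split.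
  apply: le_trans (card_weight_le _ _ _ (fun j t => r j * cell_depth t) _) _.
  have -> : \prod_j (expR 1 / mu j) = expR n%:R * \prod_j (mu j)^-1.
    rewrite big_split/= prodr_const card_ord; congr (_ * _).
    by rewrite -[n%:R]mulr1 expRM_natl.
  rewrite ler_pM2l ?expR_gt0//; apply: ler_prod => j _.
  rewrite sumr_ge0/=; last by move=> *; exact: expR_ge0.
  apply: le_trans (sum_cell_depth _ _ _ (r0 j)) _.
  by rewrite /r invf_div mulrBl mul1r divff ?gt_eqF// addrC subrK.
move=> a a1.
have aj j : mu j * a j ^+ 2 <= 1.
  apply: le_trans a1; rewrite (bigD1 j)//= lerDl sumr_ge0// => i _.
  by rewrite mulr_ge0 ?sqr_ge0// ltW.
have /fin_all_exists[t tP] : forall j, exists t : cell K,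
  [/\ cell_depth t * eta j <= `|a j|,
    `|a j - cell_center t * eta j| <= eta j &
    `|a j - cell_center t * eta j| <= `|a j|].
  move=> j; apply: cell_exists => //.
  rewrite -ltr_sqr ?nnegrE ?mulr_ge0 ?ler0n ?(ltW (eta0 j))//.
  rewrite real_normK ?num_real// -(ltr_pM2l (mu0 j)) (le_lt_trans (aj j))//.
  rewrite exprMn mulrCA.
  have : 1 < K%:R * (mu j * eta j ^+ 2).
    have := K_gt j; rewrite ltr_pdivrMr// rE.
    by rewrite mulrCA -[X in X < _]mulr1 ltr_pM2l// n0.
  move/lt_le_trans; apply; rewrite ler_pM2r ?mulr_gt0 ?exprn_gt0//.
  rewrite -natrX ler_nat (@leq_trans (2 * K + 1))//.
    by rewrite addn1 ltnW// ltnS leq_pmull.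
  by rewrite leq_pmulr ?addn1.
(* The chosen cells are admissible: r_j depth_j <= r_j depth_j^2 = n mu_j (depth_j eta_j)^2 <= n
   mu_j a_j^2. *)
have fA : [ffun j => t j] \in A.
  rewrite inE; apply: (@le_trans _ _ (\sum_j n%:R * (mu j * a j ^+ 2))).
    apply: ler_sum => j _; rewrite ffunE rE -mulrA ler_pM2l ?n0//.
    rewrite -mulrA ler_pM2l//.
    have [d0 d1] := andP (@cell_depth_le_sqr R _ (t j)); have [dj _ _] := tP j.
    rewrite mulrC (le_trans (ler_wpM2r (sqr_ge0 _) d1))// -exprMn.
    rewrite -[leRHS]real_normK ?num_real// ler_sqr ?nnegrE ?mulr_ge0//.
    exact: ltW.
  by rewrite -mulr_sumr ler_piMr.
exists (enum_rank_in fA [ffun j => t j]); rewrite enum_rankK_in//.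
(* The terms 1 / n sum to 1, but to 0 when [n] is 0; hence an inequality is used. *)
have -> : 1 + \sum_j mu j * a j ^+ 2 =
    1 - \sum_(j < n) n%:R^-1 + \sum_j (n%:R^-1 + mu j * a j ^+ 2).
  by rewrite big_split/= addrA subrK.
rewrite -[leLHS]add0r lerD//.
  rewrite subr_ge0 sumr_const card_ord -[leLHS]mulr_natl.
  by have [->|n1] := eqVneq n 0%N; rewrite ?mul0r// divff// pnatr_eq0.
apply: ler_sum => j _; rewrite ffunE; have [_ d1 d2] := tP j.
(* The share 1 - mu_j of the squared error is bounded through eta_j, the share mu_j through
   |a_j|. *)
set d := a j - _; have -> : d ^+ 2 = (1 - mu j) * d ^+ 2 + mu j * d ^+ 2 by ring.
rewrite -(etaE j) mulrC lerD// ?ler_pM2l ?ler_pM2r// -real_normK ?num_real//.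
  by rewrite ler_sqr ?nnegrE// ltW.
by rewrite -[leRHS]real_normK ?num_real// ler_sqr ?nnegrE.
Qed.

(** * Powers, factorials and the exponential *)

Lemma expr_div_fact_le (R : realType) (x : R) (n : nat) :
  0 <= x -> x ^+ n / n`!%:R <= expR x.
Proof.
move=> x0; case: n => [|n].
  by rewrite expr0 fact0 divr1 -[1]expR0 ler_expR.
by have := expR_ge1Dxn n x0; apply: le_trans; rewrite lerDr.
Qed.

Lemma prod_powR_div (R : realType) (m alpha : R) (n : nat) : 0 <= m ->
  \prod_(j < n) (m / j.+1%:R) `^ alpha = (m ^+ n / n`!%:R) `^ alpha.
Proof.
move=> m0; elim: n => [|n IH].
  by rewrite big_ord0 expr0 fact0 divr1 powR1.
rewrite big_ord_recr/= IH -powRM ?divr_ge0 ?exprn_ge0//; congr (_ `^ _).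
by rewrite exprSr factS natrM invfM; ring.
Qed.

(** * Eigenvector expansions in [H] and in [V] *)

(** The weights [l] let one formula serve both spaces: the eigenvectors have squared norm 1 in [H]
    and [lam j] in [V]. *)
Lemma norm_sub_sum_sqr (R : realType) (E : hilbertType R) (n : nat)
    (e : 'I_n -> E) (l : 'I_n -> R) (x : E) (b : 'I_n -> R) :
  (forall j k, inner (e j) (e k) = l j * (j == k)%:R) ->
  `|x - \sum_(j < n) b j *: e j| ^+ 2 =
    `|x| ^+ 2 - 2 * \sum_(j < n) b j * inner x (e j) +
    \sum_(j < n) l j * b j ^+ 2.
Proof.
move=> eo.
have xS y :
    inner y (\sum_(j < n) b j *: e j) = \sum_(j < n) b j * inner y (e j).
  by rewrite linear_sum; apply: eq_bigr => j _; rewrite linearZ.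
rewrite !inner_normE linearBl/= !linearB/= !xS (innerC _ x) xS.
have -> : \sum_(j < n) b j * inner (\sum_(k < n) b k *: e k) (e j) =
    \sum_(j < n) l j * b j ^+ 2.
  apply: eq_bigr => j _; rewrite innerC xS (bigD1 j)//= big1 => [|k kj].
    by rewrite eo eqxx mulr1 addr0 mulrA mulrC -expr2.
  by rewrite eo eq_sym (negbTE kj) !mulr0.
by ring.
Qed.

Section gelfand_triple.
Context {R : realType} {V H : hilbertType R}.
Variables (i : {linear V -> H}) (i_compact : compact_map i).
Variables (lam : nat -> R) (w : nat -> V).
Hypothesis w_basis : orthonormal_basis (i \o w).
Hypothesis w_eig : forall j,
  duality_map (w j) = to_dual i_compact (lam j *: i (w j)).

Lemma inner_eig (v : V) (j : nat) : inner v (w j) = lam j * inner (i v) (i (w j)).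
Proof.
rewrite innerC -duality_mapE w_eig to_dualE innerC linearZ/=.
by rewrite innerC.
Qed.

Lemma orthogonal_eig (j k : nat) : inner (w j) (w k) = lam j * (j == k)%:R.
Proof.
have [+ _] := w_basis => /(_ j k)/= E; rewrite inner_eig E.
by have [->//|] := eqVneq; rewrite !mulr0.
Qed.

(** Pythagoras: the omitted part and the errors on the kept coordinates add up. *)
Lemma norm_sub_eig_expansion (u : V) (n : nat) (b : 'I_n -> R) :
  `|i u - \sum_(j < n) b j *: i (w j)| ^+ 2 = `|i u| ^+ 2 -
    \sum_(j < n) inner (i u) (i (w j)) ^+ 2 +
    \sum_(j < n) (inner (i u) (i (w j)) - b j) ^+ 2.
Proof.
rewrite (@norm_sub_sum_sqr _ _ _ (i \o w \o val) (fun=> 1))/=; last first.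
  by move=> j k; rewrite (proj1 w_basis) mul1r.
rewrite mulr_sumr -!addrA -!sumrN -!big_split/=; congr (_ + _).
by apply: eq_bigr => j _; ring.
Qed.

(** The difference is the squared V-norm of [u] minus its partial expansion. *)
Lemma bessel_eig (u : V) (n : nat) :
  \sum_(j < n) lam j * inner (i u) (i (w j)) ^+ 2 <= `|u| ^+ 2.
Proof.
rewrite -subr_ge0.
have := sqr_ge0 `|u - \sum_(j < n) inner (i u) (i (w j)) *: w j|.
rewrite (norm_sub_sum_sqr _ _ _ (w \o val) (lam \o val) _
  (fun j => inner (i u) (i (w j)))) => [|j k]; last exact: orthogonal_eig.
congr (_ <= _); rewrite mulr_sumr -addrA; congr (_ + _).
rewrite -!sumrN -big_split/=; apply: eq_bigr => j _.
by rewrite inner_eig; ring.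
Qed.

(** Density gives a combination close to [i u]; replacing its coefficients by those of [i u] does
    not increase the distance. *)
Lemma bessel_approx (u : V) (eta : R) : 0 < eta -> exists N : nat,
  `|i u| ^+ 2 - \sum_(j < N) inner (i u) (i (w j)) ^+ 2 <= eta.
Proof.
move=> eta0; have s0 : 0 < Num.sqrt eta by rewrite sqrtr_gt0.
have B0 : ball (i u) (Num.sqrt eta) !=set0 by exists (i u); exact: ballxx.
have Bo : open (ball (i u) (Num.sqrt eta)) by exact: ball_open.
have [x [Bx [N [b xE]]]] := proj2 w_basis _ B0 Bo.
exists N; move: Bx; rewrite -ball_normE/= xE => Bx.
have := norm_sub_eig_expansion u N (fun j => b j).
have : `|i u - \sum_(j < N) b j *: i (w j)| ^+ 2 <= eta.
  by rewrite -[leRHS]sqr_sqrtr ?(ltW eta0)// ler_sqr ?nnegrE ?sqrtr_ge0// ltW.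
have : 0 <= \sum_(j < N) (inner (i u) (i (w j)) - b j) ^+ 2.
  by apply: sumr_ge0 => j _; exact: sqr_ge0.
by lra.
Qed.

Hypothesis lam_gt0 : 0 < lam 0%N.
Hypothesis lam_nd : nondecreasing_seq lam.

(** Each omitted coordinate has eigenvalue at least [lam n]. Finite tails are compared first; Bessel
    in [V] and density then give the whole tail. *)
Lemma tail_le (u : V) (n : nat) :
  lam n * (`|i u| ^+ 2 - \sum_(j < n) inner (i u) (i (w j)) ^+ 2) <=
  `|u| ^+ 2 - \sum_(j < n) lam j * inner (i u) (i (w j)) ^+ 2.
Proof.
have ln0 : 0 < lam n := lt_le_trans lam_gt0 (lam_nd _ _ (leq0n n)).
pose a j := inner (i u) (i (w j)).
have S p : lam n * (\sum_(j < n + p) a j ^+ 2 - \sum_(j < n) a j ^+ 2) <=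
    \sum_(j < n + p) lam j * a j ^+ 2 - \sum_(j < n) lam j * a j ^+ 2.
  elim: p => [|p IH]; first by rewrite addn0 !subrr mulr0.
  rewrite addnS !big_ord_recr/=.
  have := ler_wpM2r (sqr_ge0 (a (n + p)%N)) (lam_nd _ _ (leq_addr p n)).
  by lra.
apply/ler_addgt0Pr => e e0.
have [N NE] := bessel_approx u _ (divr_gt0 e0 ln0).
have M : \sum_(j < N) a j ^+ 2 <= \sum_(j < n + N) a j ^+ 2.
  rewrite addnC; elim: (n) => [|p IH]; first by rewrite addn0.
  by rewrite addnS big_ord_recr/= (le_trans IH)// lerDl sqr_ge0.
have := S N; have := bessel_eig u (n + N); rewrite -/a -!/(a _).
have : lam n * (`|i u| ^+ 2 - \sum_(j < n + N) a j ^+ 2) <= e.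
  rewrite mulrC -ler_pdivlMr// (le_trans _ NE)// lerD2l lerN2; exact: M.
rewrite /a; lra.
Qed.

End gelfand_triple.

(** * From the covering to the entropy *)

Lemma entropy_le (R : realType) (X : normedModType R) (M : set X) (eps : R)
    (N : nat) (x : R) :
  coverable M eps N -> N%:R <= expR x -> (entropy M eps <= (x / ln 2)%:E)%E.
Proof.
move=> cN Nx; rewrite /entropy EFinM.
apply: lee_wpmul2r; first by rewrite lee_fin invr_ge0 ln_ge0// ler1n.
have cov0 : (0 <= covering_number M eps)%E.
  by apply: le_ereal_inf_tmp => _ [n _ <-]; rewrite lee_fin.
have -> : x%:E = lne (expR x)%:E by rewrite lne_EFin ?expR_gt0// expRK.
rewrite lee_lne ?in_itv/= ?cov0 ?leey// ?lee_fin ?expR_ge0//.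
apply: (@le_trans _ _ N%:R%:E); last by rewrite lee_fin.
by apply: ereal_inf_lbound; exists N.
Qed.

Lemma prod_expR_div_le (R : realType) (n : nat) (m alpha : R) (mu : 'I_n -> R) :
  0 < alpha -> n%:R <= m -> (forall j, 0 < mu j) ->
  (forall j, (mu j)^-1 <= (m / j.+1%:R) `^ alpha) ->
  \prod_j (expR 1 / mu j) <= expR (m * (1 + alpha)).
Proof.
move=> alpha0 nm mu0 mu_ge; have m0 : 0 <= m := le_trans (ler0n _ _) nm.
rewrite big_split/= prodr_const card_ord -expRM_natl mulr1 mulrDr mulr1 expRD.
apply: ler_pM; rewrite ?expR_ge0 ?ler_expR//.
  by apply: prodr_ge0 => j _; rewrite invr_ge0 ltW.
rewrite expRM; apply: (@le_trans _ _ (\prod_(j < n) (m / j.+1%:R) `^ alpha)).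
  by apply: ler_prod => j _; rewrite mu_ge invr_ge0 ltW.
rewrite prod_powR_div//; apply: ge0_ler_powR;
  rewrite ?nnegrE ?expR_ge0 ?(ltW alpha0)//.
  by rewrite divr_ge0// exprn_ge0.
exact: expr_div_fact_le.
Qed.

(** This rests on exp(-1/6) >= 5/6 and (5/6)^6 > 1/3. *)
Lemma expR1_lt3 (R : realType) : expR 1 < 3 :> R.
Proof.
have e6 : (5 / 6) ^+ 6 <= expR (- 1) :> R.
  rewrite (_ : - 1 = 6%:R * - (1 / 6) :> R); last by field.
  rewrite expRM_natl lerXn2r ?nnegrE ?expR_ge0//.
  by have := expR_ge1Dx (- (1 / 6) : R); lra.
have : expR 1 * expR (- 1) = 1 :> R by rewrite -expRD subrr expR0.
have := expR_gt0 (1 : R); nra.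
Qed.

Theorem theorem2 (R : realType) (H V : hilbertType R)
    (H_inf : infinite_dimensional H) (H_sep : separable H)
    (i : {linear V -> H}) (i_inj : injective i) (i_dense : dense (range i))
    (i_compact : compact_map i)
    (lam : nat -> R) (lam_eig : eigenvalue_sequence i_compact lam)
    (c alpha : R) (c_gt0 : 0 < c) (alpha_gt0 : 0 < alpha)
    (lam_ge : forall j : nat, c * (j.+1%:R `^ alpha) <= lam j) :
  forall eps : R, 0 < eps ->
    (entropy (i @` [set u : V | (`|u| <= 1)%R]) eps <
      ((ln 3 + alpha) / ln 2 * (2 / (c * eps ^+ 2)) `^ alpha^-1)%:E)%E.
Proof.
move=> eps eps0; have [lam0 lam_nd lam_oo [w [w_basis w_eig]]] := lam_eig.
set m := _ `^ alpha^-1.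
have m0 : 0 < m by rewrite powR_gt0// divr_gt0// mulr_gt0// exprn_gt0.
pose L := 2 / eps ^+ 2.
have L0 : 0 < L by rewrite divr_gt0// exprn_gt0.
(* Thus [lam j < L] forces j + 1 < m. *)
have LE : L = c * m `^ alpha.
  rewrite /m -powRrM mulVf ?gt_eqF// powRr1; last first.
    by rewrite divr_ge0// mulr_ge0 ?sqr_ge0// ltW.
  by rewrite /L; field; rewrite !gt_eqF.
(* As indices start at 0, the least such index is the number of eigenvalues below [L]. *)
have [n nL n_min] : exists2 n, L <= lam n & forall j, (j < n)%N -> lam j < L.
  have /cvgryPge/(_ L)[p _ /(_ p (leqnn p)) /= pL] := lam_oo.
  case: (ex_minnP (ex_intro (fun p => L <= lam p) p pL)) => n nL n_min.
  by exists n => // j; rewrite ltnNge (ltNge (lam j)); apply: contraNN => /n_min.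
have lam_gt0 j : 0 < lam j := lt_le_trans lam0 (lam_nd _ _ (leq0n j)).
pose mu (j : 'I_n) := lam j / L.
have mu01 j : 0 < mu j < 1 by rewrite divr_gt0//= ltr_pdivrMr// mul1r n_min.
have mu0 j : 0 < mu j by case/andP: (mu01 j).
have nm : n%:R <= m.
  case: n n_min {nL mu mu01 mu0} => [|n] n_min; first exact: ltW.
  have := le_lt_trans (lam_ge n) (n_min n (ltnSn n)).
  rewrite LE ltr_pM2l// => /ltW; apply: contraTT; rewrite -!ltNge => mn.
  by rewrite gt0_ltr_powR// ?nnegrE ?ltW.
have mu_ge j : (mu j)^-1 <= (m / j.+1%:R) `^ alpha.
  rewrite /mu invf_div ler_pdivrMr// LE.
  have -> : c * m `^ alpha = (m / j.+1%:R) `^ alpha * (c * j.+1%:R `^ alpha).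
    by rewrite mulrCA -powRM ?divr_ge0 ?ltW// divfK.
  by rewrite ler_wpM2l ?powR_ge0.
have [N [y [NE yP]]] := ellipsoid_net _ _ _ mu01.
(* Since d^2 = 1 / L, this scale turns lam_j a_j^2 into mu_j (a_j / d)^2. *)
pose d := eps / Num.sqrt 2.
have d2 : d ^+ 2 = L^-1 by rewrite exprMn exprVn sqr_sqrtr// /L invf_div.
have d0 : 0 < d by rewrite divr_gt0 ?sqrtr_gt0.
(* Strictness comes from 1 < log 3 and m > 0. *)
apply: (@le_lt_trans _ _ (m * (1 + alpha) / ln 2)%:E); last first.
  rewrite lte_fin [ltRHS]mulrC [ltRHS]mulrA.
  rewrite ltr_pM2r ?invr_gt0 ?ln_gt0 ?ltr1n// ltr_pM2l//.
  by rewrite ltrD2r -ltr_expR lnK ?posrE// expR1_lt3.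
apply: (@entropy_le _ _ _ _ N); last first.
  by rewrite (le_trans NE)// prod_expR_div_le.
exists (fun k => \sum_(j < n) (d * y k j) *: i (w j)) => _ [u u1 <-].
pose a j := inner (i u) (i (w j)).
have muE : \sum_(j < n) mu j * (a j / d) ^+ 2 = \sum_(j < n) lam j * a j ^+ 2.
  by apply: eq_bigr => j _; rewrite exprMn exprVn d2 /mu; field; rewrite gt_eqF.
have u2 : `|u| ^+ 2 <= 1 by rewrite expr_le1.
have [|k] := yP (fun j => a j / d).
  by rewrite muE (le_trans (bessel_eig _ _ _ _ w_basis w_eig u n)).
rewrite muE => yk; exists k => //; rewrite /closed_ball_/= distrC.
rewrite -ler_sqr ?nnegrE ?(ltW eps0)//.
rewrite (norm_sub_eig_expansion _ _ w_basis u n).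
have -> : \sum_(j < n) (inner (i u) (i (w j)) - d * y k j) ^+ 2 =
    L^-1 * \sum_(j < n) (a j / d - y k j) ^+ 2.
  rewrite mulr_sumr -d2; apply: eq_bigr => j _.
  by rewrite /a; field; rewrite gt_eqF.
(* With Q the energy of the first n coordinates and S the squared tail, L S <= lam_n S <= 1 - Q. The
   net error adds at most 1 + Q, for a total of 2 = L eps^2. *)
have := tail_le _ _ _ _ w_basis w_eig lam0 lam_nd u n.
have := norm_sub_eig_expansion _ _ w_basis u n a.
have -> : \sum_(j < n) (inner (i u) (i (w j)) - a j) ^+ 2 = 0.
  by apply: big1 => j _; rewrite subrr expr0n.
rewrite addr0; set S := `|i u| ^+ 2 - _ => SE tail.
have S0 : 0 <= S by rewrite -SE sqr_ge0.
have -> : eps ^+ 2 = L^-1 * 2 by rewrite /L invf_div mulfVK.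
rewrite -(ler_pM2l L0) mulrDr !mulVKf ?gt_eqF//.
have := ler_wpM2r S0 nL; lra.
Qed.
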